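(* Let $\ell\ge1$ and $i,j\in\{1,\dots,\ell\}$. The adjoint action of the elements $S_i\in GL_{\ell+1}(\mathbb C)$ on $\mathfrak{gl}_{\ell+1}(\mathbb C)$ satisfies $$\mathrm{Ad}_{S_i}(e_j)=\begin{cases} f_j,& i=j\\ e_j,&|i-j|>1\\ \mathrm{ad}_{e_i}(e_j),& i-j=-1\\ -\mathrm{ad}_{e_i}(e_j),& i-j=1\end{cases} \qquad\text{and}\qquad \mathrm{Ad}_{S_i}(f_j)=\begin{cases} e_j,& i=j\\ f_j,&|i-j|>1\\ -\mathrm{ad}_{f_i}(f_j),& i-j=-1\\ \mathrm{ad}_{f_i}(f_j),& i-j=1.\end{cases}$$
   Context: $S_i$ is the $(\ell+1)\times(\ell+1)$ permutation matrix of the transposition $(i\;i+1)$; $e_j=e_{j,j+1}$ and $f_j=e_{j+1,j}$, where $e_{ab}$ are the standard matrix units. $\mathrm{Ad}_g(X)=gXg^{-1}$, $\mathrm{ad}_X(Y)=[X,Y]=XY-YX$. *)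

(* Defs.v *)
From HB Require Import structures.
From mathcomp Require Import all_boot all_order all_algebra all_fingroup.

Set Implicit Arguments.
Unset Strict Implicit.
Unset Printing Implicit Defensive.

Import GRing.Theory.
Local Open Scope ring_scope.

(* Indices are 0-based: the Chevalley index j in {1..l} is represented by the
   ordinal j - 1 : 'I_l, and the row/column index a in {1..l+1} by the ordinal
   a - 1 : 'I_l.+1.  Differences of indices are unaffected by the shift. *)

Section Defs.
Variables (K : fieldType) (l : nat).

(* The values j and j + 1 in 'I_l.+1, for j : 'I_l. *)
Definition lo (j : 'I_l) : 'I_l.+1 := widen_ord (leqnSn l) j.
Definition hi (j : 'I_l) : 'I_l.+1 := lift ord0 j.

Lemma val_lo (j : 'I_l) : lo j = j :> nat. Proof. by []. Qed.
Lemma val_hi (j : 'I_l) : hi j = j.+1 :> nat. Proof. by []. Qed.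

Definition che (j : 'I_l) : 'M[K]_l.+1 := delta_mx (lo j) (hi j).
Definition chf (j : 'I_l) : 'M[K]_l.+1 := delta_mx (hi j) (lo j).

Definition chS (i : 'I_l) : 'M[K]_l.+1 := tperm_mx (lo i) (hi i).

Lemma chS_unit (i : 'I_l) : chS i \in unitmx.
Proof. exact: unitmx_perm. Qed.

End Defs.

(* Only meaningful for g \in unitmx, i.e. g in GL_n(K). *)
Definition Ad (K : fieldType) (n : nat) (g X : 'M[K]_n) : 'M[K]_n :=
  g *m X *m invmx g.

Definition ad (K : fieldType) (n : nat) (X Y : 'M[K]_n) : 'M[K]_n :=
  X *m Y - Y *m X.

Arguments che K {l} j.
Arguments chf K {l} j.
Arguments chS K {l} i.

(* Main.v *)
(** Conjugation by a permutation matrix relabels the indices of a matrix unit, and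
    of the two products in the commutator of adjacent Chevalley generators exactly
    one survives; which one it is decides the sign. *)

Require Import Defs.
From mathcomp Require Import all_boot all_order all_algebra all_fingroup.
From mathcomp Require Import reals complex zify.

Import GRing.Theory.

Local Open Scope ring_scope.

(** The inverse comes from the convention for [perm_mx s]: row [x] has its 1 in column [s x], so
    conjugation reads entry [(s x, s y)] at position [(x, y)]. For a transposition the inverse
    disappears. *)
Lemma Ad_perm_mx_delta (K : fieldType) (n : nat) (s : 'S_n) (a b : 'I_n) :
  Ad (perm_mx s) (delta_mx a b : 'M[K]_n) = delta_mx (s^-1%g a) (s^-1%g b).
Proof.
rewrite /Ad; have -> : invmx (perm_mx s) = perm_mx s^-1 :> 'M[K]_n.
  rewrite -[LHS]mulmx1; apply: (canLR (mulKmx (unitmx_perm _ _))).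
  by rewrite -perm_mxM mulgV perm_mx1.
rewrite -row_permE -col_permE.
by apply/matrixP => x y; rewrite !mxE !(canF_eq (permK s)).
Qed.

Lemma Ad_chS_delta (K : fieldType) (l : nat) (i : 'I_l) (a b : 'I_l.+1) :
  Ad (chS K i) (delta_mx a b) =
  delta_mx (tperm (lo i) (hi i) a) (tperm (lo i) (hi i) b).
Proof. by rewrite /chS /tperm_mx Ad_perm_mx_delta tpermV. Qed.

Lemma ad_delta_mx (K : fieldType) (n : nat) (a b c d : 'I_n) :
  ad (delta_mx a b) (delta_mx c d) =
  delta_mx a d *+ (b == c) - delta_mx c b *+ (d == a) :> 'M[K]_n.
Proof. by rewrite /ad !mul_delta_mx_cond. Qed.

(** This and the next three equations hold by computation, as ordinals are compared by value; they
    reduce index comparisons to arithmetic that [lia] decides. *)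
Lemma lo_eq (l : nat) (i j : 'I_l) : (lo i == lo j) = (i == j :> nat).
Proof. by []. Qed.

Lemma hi_eq (l : nat) (i j : 'I_l) : (hi i == hi j) = (i == j :> nat).
Proof. by []. Qed.

Lemma lo_eq_hi (l : nat) (i j : 'I_l) : (lo i == hi j) = (i == j.+1 :> nat).
Proof. by []. Qed.

Lemma hi_eq_lo (l : nat) (i j : 'I_l) : (hi i == lo j) = (i.+1 == j :> nat).
Proof. by []. Qed.

Theorem proposition9p2 (R : realType) (l : nat) (hl : (1 <= l)%N)
    (i j : 'I_l) :
  let S := @chS R[i] l in
  let e := @che R[i] l in
  let f := @chf R[i] l in
  let d : int := (i : nat)%:Z - (j : nat)%:Z in
  [/\ i = j -> Ad (S i) (e j) = f j,
      1 < `|d| -> Ad (S i) (e j) = e j,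
      d = -1 -> Ad (S i) (e j) = ad (e i) (e j)
    & d = 1 -> Ad (S i) (e j) = - ad (e i) (e j)]
  /\
  [/\ i = j -> Ad (S i) (f j) = e j,
      1 < `|d| -> Ad (S i) (f j) = f j,
      d = -1 -> Ad (S i) (f j) = - ad (f i) (f j)
    & d = 1 -> Ad (S i) (f j) = ad (f i) (f j)].
Proof.
move=> S e f d; rewrite /S /e /f /che /chf !Ad_chS_delta !ad_delta_mx.
have far : 1 < `|d| -> tperm (lo i) (hi i) (lo j) = lo j /\
                       tperm (lo i) (hi i) (hi j) = hi j.
  by rewrite /d => d1; rewrite !tpermD // ?lo_eq ?hi_eq ?lo_eq_hi ?hi_eq_lo; lia.
(* Here [j] is [i + 1]: the shared index [lo j = hi i] is swapped to [lo i], and the [false]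
   equation kills the products [e j *m e i] and [f i *m f j]. *)
have below : d = -1 -> [/\ lo j = hi i, (hi j == lo i) = false
                         & tperm (lo i) (hi i) (hi j) = hi j].
  rewrite /d => d1; split; first by apply/eqP; rewrite lo_eq_hi; lia.
    by rewrite hi_eq_lo; lia.
  by rewrite tpermD // ?hi_eq ?lo_eq_hi; lia.
(* Here [i] is [j + 1]: the shared index is [hi j = lo i], and [e i *m e j] and [f j *m f i] vanish
   instead. *)
have above : d = 1 -> [/\ hi j = lo i, (lo j == hi i) = false
                        & tperm (lo i) (hi i) (lo j) = lo j].
  rewrite /d => d1; split; first by apply/eqP; rewrite hi_eq_lo; lia.
    by rewrite lo_eq_hi; lia.
  by rewrite tpermD // ?lo_eq ?hi_eq_lo; lia.
split; split.
- by move=> ->; rewrite tpermL tpermR.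
- by case/far=> -> ->.
- by case/below=> -> ji ->; rewrite tpermR eqxx ji subr0.
- by case/above=> -> ji ->; rewrite tpermL eqxx eq_sym ji sub0r opprK.
- by move=> ->; rewrite tpermL tpermR.
- by case/far=> -> ->.
(* Each [f] is the transpose of the matching [e], and transposition reverses products, so the other
   product survives and the signs are opposite to those for [e]. *)
- by case/below=> -> ji ->; rewrite tpermR eqxx eq_sym ji sub0r opprK.
- by case/above=> -> ji ->; rewrite tpermL eqxx ji subr0.
Qed.
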